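(* For integers $n > q \geq 9$, $$f(n;q,3) \geq \left(f(\lfloor n/\log n\rfloor;\, q-6,\,3)\right)^{n^{1/4}/2}.$$
   Context: For integers $n > q \geq t \geq 2$, $f(n;q,t)$ denotes the maximum integer $N$ such that there is a coloring of the 3-element subsets (triples) of an $N$-element set $V$ with $q$ colors with the property that every subset of $V$ of size $n$ contains triples of at least $t$ distinct colors. All logarithms are base 2. *)

(* Defs.v *)
From HB Require Import structures.
From mathcomp Require Import all_boot all_order all_algebra.
From mathcomp Require Import all_classical all_reals all_analysis.

Set Implicit Arguments.
Unset Strict Implicit.
Unset Printing Implicit Defensive.

Definition triples (V : finType) (S : {set V}) : {set {set V}} :=
  [set e : {set V} | (e \subset S) && (#|e| == 3)].

(* [chi] is total on {set V}, but only its values on triples are ever used. *)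
Definition colors_in (V : finType) (q : nat) (chi : {set V} -> 'I_q)
  (S : {set V}) : {set 'I_q} := [set chi e | e in triples S].

Definition has_good_coloring (n q t N : nat) : Prop :=
  exists chi : {set 'I_N} -> 'I_q,
    forall S : {set 'I_N}, #|S| = n -> t <= #|colors_in chi S|.

Definition is_max (P : nat -> Prop) (N : nat) : Prop :=
  P N /\ forall N', P N' -> N' <= N.

(* The value 0 is taken if the maximum does not exist; [f_is_max] below shows
   that it does exist whenever n, q >= 1 and t >= 2. *)
Definition f (n q t : nat) : nat := xget 0 (is_max (has_good_coloring n q t)).

Definition log2 (R : realType) (x : R) : R := (ln x / ln 2)%R.

Definition homogeneous (V : finType) (q k : nat) (chi : {set V} -> 'I_q)
    (S : {set V}) (c : 'I_q) : Prop :=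
  forall e : {set V}, e \subset S -> #|e| = k -> chi e = c.

Lemma ramsey_offdiag_step (q k : nat) :
  (forall n, exists M, forall (V : finType) (A : {set V})
     (chi : {set V} -> 'I_q), M <= #|A| ->
     exists c (S : {set V}), [/\ S \subset A, #|S| = n & homogeneous k chi S c]) ->
  forall l, exists M, forall (V : finType) (A : {set V})
     (chi : {set V} -> 'I_q) (g : 'I_q -> nat),
     \sum_c g c <= l -> M <= #|A| ->
     exists c (S : {set V}), [/\ S \subset A, #|S| = g c & homogeneous k.+1 chi S c].
Proof.
move=> Pk.
have base (V : finType) (A : {set V}) (chi : {set V} -> 'I_q)
    (g : 'I_q -> nat) (c : 'I_q) : g c = 0 ->
    exists c (S : {set V}), [/\ S \subset A, #|S| = g c & homogeneous k.+1 chi S c].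
  move=> gc0; exists c, finset.set0; split; rewrite ?finset.sub0set ?cards0 ?gc0 //.
  by move=> e; rewrite finset.subset0 => /eqP->; rewrite cards0.
elim=> [|l [M IHM]].
  exists 0 => V A chi g; rewrite leqn0 sum_nat_eq0 => /forallP g0 _.
  by apply: (base _ _ _ _ (chi finset.set0)); exact/eqP/(implyP (g0 _)).
have [M' HM'] := Pk M.
exists M'.+1 => V A chi g le_g le_A.
have [[c gc0]|gN0] := pselect (exists c, g c = 0); first exact: base gc0.
have g_gt0 c : 0 < g c by rewrite lt0n; apply/eqP => gc0; apply: gN0; exists c.
have /card_gt0P [x xA] : 0 < #|A| by apply: leq_trans le_A.
have le_Ax : M' <= #|A :\ x| by move: le_A; rewrite (cardsD1 x A) xA.
have [c0 [S' [S'A cardS' homS']]] := HM' V _ (fun e => chi (x |: e)) le_Ax.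
pose g' c := if c == c0 then (g c).-1 else g c.
have le_g' : \sum_c g' c <= l.
  rewrite -ltnS; apply: leq_trans le_g.
  rewrite (bigD1 c0) //= [leqRHS](bigD1 c0) //= /g' eqxx.
  rewrite -addSn prednK // leq_add2l; apply: leq_sum => c /negPf-> //.
have [c [S [SS' cardS homS]]] := IHM V S' chi g' le_g' (eq_leq (esym cardS')).
have SAx := fintype.subset_trans SS' S'A.
have SA : S \subset A by apply: fintype.subset_trans SAx _; exact: finset.subD1set.
move: cardS; rewrite /g'; case: eqVneq => [cc0|_] cardS; last by exists c, S.
have xS : x \notin S.
  by apply/negP => /(fintype.subsetP SAx); rewrite !inE eqxx.
exists c, (x |: S); split.
- by rewrite finset.subUset finset.sub1set xA.
- by rewrite cardsU1 xS cardS add1n prednK.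
move=> e esub ek; case: (boolP (x \in e)) => xe; last first.
  apply: homS => //; apply/fintype.subsetP => y ye.
  have := fintype.subsetP esub y ye; rewrite !inE => /orP[/eqP yx|//].
  by rewrite -yx ye in xe.
rewrite -(finset.setD1K xe) cc0; apply: homS'; last first.
  by move: ek; rewrite (cardsD1 x e) xe add1n => -[].
apply: fintype.subset_trans SS'; apply/fintype.subsetP => y.
by rewrite !inE => /andP[/negPf yx /(fintype.subsetP esub)]; rewrite !inE yx.
Qed.

Lemma ramsey (q k n : nat) : exists M, forall (V : finType) (A : {set V})
  (chi : {set V} -> 'I_q), M <= #|A| ->
  exists c (S : {set V}), [/\ S \subset A, #|S| = n & homogeneous k chi S c].
Proof.
elim: k n => [|k IHk] n.
  exists n => V A chi le_A.
  have [S SA cardS] : exists2 S : {set V}, S \subset A & #|S| = n.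
    have : 0 < #|[set S : {set V} | S \subset A & #|S| == n]|.
      by rewrite cards_draws bin_gt0.
    by case/card_gt0P => S; rewrite inE => /andP[SA /eqP]; exists S.
  exists (chi finset.set0), S; split=> // e _ /eqP.
  by rewrite cards_eq0 => /eqP->.
have [M HM] := ramsey_offdiag_step IHk (q * n).
exists M => V A chi le_A.
by apply: (HM V A chi (fun=> n)); rewrite // sum_nat_const card_ord.
Qed.

Lemma f_is_max (n q t : nat) : 0 < n -> 0 < q -> 1 < t ->
  is_max (has_good_coloring n q t) (f n q t).
Proof.
move=> n_gt0 q_gt0 t_gt1; apply: xgetPex.
have [M HM] := ramsey q 3 n.
have bnd N : has_good_coloring n q t N -> N <= M.
  move=> [chi Hchi]; rewrite leqNgt; apply/negP => ltMN.
  have [|c [S [_ cardS homS]]] := HM _ [set: 'I_N]%SET chi.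
    by rewrite cardsT card_ord ltnW.
  have := leq_trans t_gt1 (Hchi S cardS); rewrite ltnNge => /negP; apply.
  rewrite -(cards1 c); apply/subset_leq_card/fintype.subsetP => d.
  case/imsetP => e; rewrite !inE => /andP[eS /eqP e3] ->.
  by apply/eqP/homS.
have ex0 : exists N, `[< has_good_coloring n q t N >].
  exists 0; apply/asboolP; exists (fun=> Ordinal q_gt0) => S cardS.
  by have := max_card (mem S); rewrite cardS card_ord leqNgt n_gt0.
have bnd' N : `[< has_good_coloring n q t N >] -> N <= M by move/asboolP/bnd.
case: (ex_maxnP ex0 bnd') => N /asboolP goodN maxN.
by exists N; split=> // N' goodN'; apply/maxN/asboolP.
Qed.

(* Main.v *)
Require Import Defs.
From mathcomp Require Import all_boot all_order all_algebra.
From mathcomp Require Import all_classical all_reals all_analysis.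
From mathcomp Require Import zify.

(* A point of 'I_M ^ d is a leaf of the M-ary tree of depth d.  If the three
   branches of a triple separate at one node, the triple gets the color that
   the given coloring assigns to the three children.  Otherwise two of the
   points separate from the third at a level i and from each other at a deeper
   level j, and the triple is colored by the side on which the pair lies
   together with phi i j, where phi is a 2-coloring of the pairs of levels
   without monochromatic cliques of size w + 1; this uses 4 new colors.

   Suppose that S spans at most two colors.  No node of the tree of S has m
   children, as these would give three colors.  If both sides occur, no node
   has three children and on every branch the levels split into two
   monochromatic cliques, so #|S| <= 4 ^ w.  If one side occurs, the tree is a
   caterpillar: either it is binary and #|S| <= d + 1, or a third child
   uses up a color, the branching levels form one monochromatic clique, and
   #|S| <= 1 + w (m - 1).  Taking w maximal with 4 ^ w < n makes all
   of these less than n, and d ^ 2 <= 2 ^ w, which suffices for phi to exist,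
   allows d >= n ^ (1/4) / 2. *)

Set Implicit Arguments.
Unset Strict Implicit.
Unset Printing Implicit Defensive.

(** [has_good_coloring] speaks of ordinals, while the tree coloring lives on nested pairs with
    colors in a sum type; enumerations transport it. *)
Lemma has_good_coloring_finType (V C : finType) (n q t : nat)
    (chi : {set V} -> C) : #|C| <= q ->
  (forall S : {set V}, #|S| = n -> t <= #|[set chi e | e in triples S]|) ->
  has_good_coloring n q t #|V|.
Proof.
move=> leCq chiP.
exists (fun e : {set 'I_#|V|} =>
  widen_ord leCq (enum_rank (chi [set enum_val i | i in e]))).
move=> S cardS; pose g (i : 'I_#|V|) : V := enum_val i.
have g_inj : injective g by exact: enum_val_inj.
have := chiP [set g i | i in S].
rewrite card_imset // => /(_ cardS) /leq_trans; apply.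
pose h c : 'I_q := widen_ord leCq (enum_rank c).
have h_inj : injective h by move=> c c' /(congr1 val) /= /val_inj /enum_rank_inj.
rewrite -(card_imset _ h_inj); apply/subset_leq_card/fintype.subsetP => y.
case/imsetP => _ /imsetP[e eT ->] ->; apply/imsetP.
move: eT; rewrite inE => /andP[eS /eqP e3].
have ge : [set g i | i in g @^-1: e] = e.
  apply/setP => x; apply/imsetP/idP => [[i]|xe]; first by rewrite inE => ? ->.
  by exists (enum_rank x); rewrite ?inE /g enum_rankK.
exists (g @^-1: e); last by rewrite /h -/g ge.
rewrite inE; apply/andP; split.
  apply/fintype.subsetP => i; rewrite inE => /(fintype.subsetP eS).
  by case/imsetP => j jS /g_inj ->.
by rewrite -(card_imset _ g_inj) ge e3.
Qed.

(** * Erdos lower bound for two-color graph Ramsey numbers *)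

Lemma card_mono_ffun (T C : finType) (A : {set T}) (c : C) :
  #|[set phi : {ffun T -> C} | [forall x in A, phi x == c]]| =
  #|C| ^ (#|T| - #|A|).
Proof.
pose F x : pred C := if x \in A then pred1 c else predT.
transitivity #|family F|.
  apply: eq_card => phi; rewrite inE; apply/forall_inP/familyP => H x.
    by rewrite /F; case: ifP => // xA; rewrite !inE H.
  by move=> xA; have := H x; rewrite /F xA.
rewrite card_family foldrE big_map big_enum /=.
rewrite (bigID (mem A)) /= big1 ?mul1n => [|x xA]; last by rewrite /F xA card1.
rewrite (eq_bigr (fun=> #|C|)) => [|x /negPf xA]; last by rewrite /F xA; exact: eq_card.
rewrite prod_nat_const -(finset.cardsC A) addKn.
by congr (_ ^ _); apply: eq_card => x; rewrite !inE.
Qed.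

Lemma subset_of_card (T : finType) (A : {set T}) (k : nat) : k <= #|A| ->
  exists2 B : {set T}, B \subset A & #|B| = k.
Proof.
move=> kA.
have /card_gt0P[B] : 0 < #|[set B : {set T} | B \subset A & #|B| == k]|.
  by rewrite cards_draws bin_gt0.
by rewrite inE => /andP[BA /eqP]; exists B.
Qed.

(** As [2 * 'C(w.+1, 2) = w.+1 * w], comparing squares bounds the falling factorial of [d] by
    [2 ^ 'C(w.+1, 2)]. Dividing by the factorial of [w.+1], at least 6 once [w > 1], absorbs the
    factor 2. *)
Lemma two_bin_lt (d w : nat) : 0 < w -> d ^ 2 <= 2 ^ w ->
  2 * 'C(d, w.+1) < 2 ^ 'C(w.+1, 2).
Proof.
move=> w_gt0 le_dw.
have [dw|wd] := ltnP d w.+1; first by rewrite bin_small // muln0 expn_gt0.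
have w_gt1 : 1 < w.
  case: w w_gt0 le_dw wd => [|[|w]] // _.
  by case: d => [|[|d]] //; rewrite -mulnn; lia.
have le_ffact : d ^_ w.+1 <= 2 ^ 'C(w.+1, 2).
  rewrite -leq_sqr -expnM bin2 muln2 halfK oddM /= andNb subn0 -[_ * w]mulnC expnM.
  apply: (@leq_trans ((d ^ w.+1) ^ 2)).
    rewrite leq_sqr -(card_ord d) -(card_ord w.+1) -card_inj_ffuns -card_ffun.
    exact: max_card.
  by rewrite -expnM mulnC expnM leq_exp2r.
have le_fact : 6 <= (w.+1)`! by rewrite (@leq_fact 3).
have := bin_ffact d w.+1; have : 0 < 'C(d, w.+1) by rewrite bin_gt0.
nia.
Qed.

(* The union bound of Erdos: each of the 'C(d, w.+1) sets is monochromatic in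
   2 * 2 ^ (N - 'C(w.+1, 2)) of the 2 ^ N colorings. *)
Lemma ramsey_lower_set (d w : nat) : 0 < w -> d ^ 2 <= 2 ^ w ->
  exists phi : {set 'I_d} -> bool, forall (c : bool) (K : {set 'I_d}),
    (forall e : {set 'I_d}, e \subset K -> #|e| = 2 -> phi e = c) -> #|K| <= w.
Proof.
move=> w_gt0 le_dw.
have [dw|wd] := leqP d w.
  by exists xpredT => c K _; rewrite (leq_trans (max_card _)) ?card_ord.
pose pairs (K : {set 'I_d}) := [set e : {set 'I_d} | e \subset K & #|e| == 2].
pose mono (cK : bool * {set 'I_d}) :=
  [set phi : {ffun {set 'I_d} -> bool} | [forall e in pairs cK.2, phi e == cK.1]].
pose N := #|{set 'I_d}|; pose k := w.+1.
pose D := finset.setX [set: bool]%SET [set K : {set 'I_d} | #|K| == k].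
pose bad := (\bigcup_(cK in D) mono cK)%SET.
(* Colorings are total on all [N] subsets, not only on pairs; this bound makes the exponent
   [N - 'C(k, 2)] a true difference. *)
have le_CN : 'C(k, 2) <= N.
  apply: (@leq_trans 'C(d, 2)); first exact: leq_bin2l.
  by rewrite -[d in 'C(d, 2)]card_ord -card_draws max_card.
have : #|bad| < #|{ffun {set 'I_d} -> bool}|.
  apply: (@leq_ltn_trans (2 * 'C(d, k) * 2 ^ (N - 'C(k, 2)))); last first.
    rewrite card_ffun card_bool -/N -[in ltnRHS](subnKC le_CN) expnD.
    by rewrite ltn_pmul2r ?expn_gt0 // two_bin_lt.
  apply: (@leq_trans (\sum_(cK in D) #|mono cK|)).
    rewrite /bad; elim/big_rec2: _ => [|cK A m _ IH]; first by rewrite cards0.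
    by rewrite (leq_trans (leq_card_setU _ _).1) // leq_add2l.
  rewrite (eq_bigr (fun=> 2 ^ (N - 'C(k, 2)))) => [|[c K]]; last first.
    rewrite !inE /= => /eqP cardK.
    by rewrite card_mono_ffun card_bool cards_draws cardK.
  rewrite sum_nat_const leq_mul2r cardsX cardsT card_bool.
  by rewrite card_draws card_ord leqnn orbT.
rewrite -(finset.cardsC bad) -{1}[#|bad|]addn0 ltn_add2l => /card_gt0P[phi].
rewrite inE => phiN; exists phi => c K homK; rewrite leqNgt; apply/negP => ltwK.
have [K' K'K cardK'] := subset_of_card ltwK.
move/negP: phiN; apply; apply/bigcupP; exists (c, K'); first by rewrite !inE cardK' /=.
rewrite inE; apply/forall_inP => e; rewrite inE /= => /andP[eK' /eqP e2].
by apply/eqP/homK => //; exact: fintype.subset_trans eK' K'K.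
Qed.

(** Cliques become strictly decreasing sequences of numbers, the form in which levels are collected
    down a branch. *)
Lemma ramsey_lower (d w : nat) : 0 < w -> d ^ 2 <= 2 ^ w ->
  exists phi : nat -> nat -> bool, forall (c : bool) (K : seq nat),
    all (fun j => j < d) K -> pairwise [rel i j | (j < i) && (phi i j == c)] K ->
    size K <= w.
Proof.
move=> w_gt0 le_dw; have [phi phiP] := ramsey_lower_set w_gt0 le_dw.
case: d le_dw phi phiP => [|d] le_dw phi phiP.
  by exists (fun _ _ => true) => c [|].
exists (fun i j => phi [set inord i; inord j]) => c K ltK pwK.
have uK : uniq K.
  have : pairwise gtn K by apply: sub_pairwise pwK => i j /andP[].
  by move=> /(pairwise_uniq (fun i => ltnn i)).
pose K' := [set i : 'I_d.+1 | val i \in K].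
have -> : size K = #|K'|.
  rewrite -(size_map (@inord d)) -(card_uniqP _).
    apply: eq_card => i; rewrite inE; apply/mapP/idP => [[j jK ->]|iK].
      by rewrite /= inordK // (allP ltK).
    by exists (val i); rewrite ?inord_val.
  rewrite map_inj_in_uniq // => i j iK jK /(congr1 (@nat_of_ord _)).
  by rewrite !inordK // (allP ltK).
apply: (phiP c) => e eK /eqP/cards2P[i [j [ij Ee]]].
have memK x : x \in e -> val x \in K by move/(fintype.subsetP eK); rewrite inE.
have {memK} [iK jK] : val i \in K /\ val j \in K.
  by split; apply: memK; rewrite Ee !inE eqxx ?orbT.
have key (x y : 'I_d.+1) : index (val x) K < index (val y) K -> val y \in K ->
    phi [set x; y] = c.
  move=> lxy yK; have lyK : index (val y) K < size K by rewrite index_mem.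
  have := (pairwiseP 0 pwK) _ _ (ltn_trans lxy lyK) lyK lxy.
  rewrite !nth_index -?index_mem ?(ltn_trans lxy lyK) //= !inord_val.
  by case/andP=> _ /eqP.
have := ltngtP (index (val i) K) (index (val j) K); case=> [lt|gt|eq].
- by rewrite Ee key.
- by rewrite Ee finset.setUC key.
by move: ij; rewrite -val_eqE /= -(nth_index 0 iK) eq nth_index // eqxx.
Qed.

(** * The coloring of the leaves of the tree *)

Section ProductColoring.

Variables (M p : nat) (chi : {set 'I_M} -> 'I_p) (phi : nat -> nat -> bool).

Local Notation color := ('I_p + bool * bool)%type.

Fixpoint leaf (d : nat) : finType :=
  if d is d'.+1 then ('I_M * leaf d')%type else unit.

Lemma card_leaf d : #|leaf d| = M ^ d.
Proof. by elim: d => [|d IH] /=; rewrite ?card_unit // card_prod card_ord IH expnS. Qed.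

(* Levels are counted from the leaves: the root of [leaf d] has level [d.-1]. *)
Fixpoint split_level (d : nat) : leaf d -> leaf d -> nat :=
  if d is d'.+1 then
    fun x y => if x.1 == y.1 then split_level x.2 y.2 else d'
  else fun _ _ => 0.

(* [None] arises only for coinciding points. *)
Fixpoint tri (d : nat) : leaf d -> leaf d -> leaf d -> option color :=
  if d is d'.+1 then fun x y z =>
    if x.1 == y.1 then
      if y.1 == z.1 then tri x.2 y.2 z.2
      else Some (inr (x.1 < z.1, phi d' (split_level x.2 y.2)))
    else if y.1 == z.1 then Some (inr (y.1 < x.1, phi d' (split_level y.2 z.2)))
    else if x.1 == z.1 then Some (inr (x.1 < y.1, phi d' (split_level x.2 z.2)))
    else Some (inl (chi [set x.1; y.1; z.1]))
  else fun _ _ _ => None.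

Lemma split_levelC d (x y : leaf d) : split_level x y = split_level y x.
Proof. by elim: d x y => //= d IH x y; rewrite IH eq_sym. Qed.

Lemma split_level_lt d (x y : leaf d) : x != y -> split_level x y < d.
Proof.
elim: d x y => [[] []|d IH [a x] [b y]] //=.
rewrite xpair_eqE; case: eqVneq => //= _ /IH; exact: ltnW.
Qed.

(** With [triC23] this generates all permutations of three points, so [tri] descends to unordered
    triples. *)
Lemma triC12 d (x y z : leaf d) : tri y x z = tri x y z.
Proof.
elim: d x y z => //= d IH [a x] [b y] [c z] /=; rewrite (eq_sym b a).
case: (eqVneq a b) => [<-|ab]; first by rewrite IH split_levelC.
case: (eqVneq a c) => [<-|ac]; rewrite ?(eq_sym b a) ?(negPf ab) //.
by rewrite (finset.setUC [set b]).
Qed.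

Lemma triC23 d (x y z : leaf d) : tri x z y = tri x y z.
Proof.
elim: d x y z => //= d IH [a x] [b y] [c z] /=; rewrite (eq_sym c b).
case: (eqVneq a b) => [<-|ab]; case: (eqVneq a c) => [ac|ac] //=.
  by rewrite -ac eq_sym (negPf ab).
case: (eqVneq b c) => [bc|bc]; first by rewrite -bc split_levelC.
by rewrite finset.setUAC.
Qed.

(** [P] is only an upper bound for the colors on [S], so it passes unchanged to subtrees. *)
Definition colored d (P : color -> bool) (S : {set leaf d}) : Prop :=
  {in S & & , forall x y z, x != y -> y != z -> x != z ->
    forall c, tri x y z = Some c -> P c}.

Definition child d (S : {set leaf d.+1}) (a : 'I_M) : {set leaf d} :=
  [set y | (a, y) \in S].

Definition roots d (S : {set leaf d.+1}) : {set 'I_M} := [set x.1 | x in S].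

(** These are the levels at which the tree of [S] branches. *)
Definition level d (S : {set leaf d}) (j : nat) : Prop :=
  exists x y, [/\ x \in S, y \in S, x != y & split_level x y = j].

Lemma level_lt d (S : {set leaf d}) j : level S j -> j < d.
Proof. by case=> x [y [_ _ xy <-]]; exact: split_level_lt. Qed.

Lemma card_child d (S : {set leaf d.+1}) : #|S| = \sum_(a in roots S) #|child S a|.
Proof.
rewrite -sum1_card (partition_big (fun x : leaf d.+1 => x.1) (mem (roots S))) => [|x xS] /=.
  apply: eq_bigr => a _; rewrite sum1dep_card -[RHS](@card_imset _ _ (pair a)) => [|x y []//].
  apply: eq_card => -[b y]; rewrite !inE /=; apply/andP/imsetP => [[yS /eqP Eb]|[z]].
    by exists y; rewrite ?inE -Eb.
  by rewrite inE => ? [-> ->].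
exact: imset_f.
Qed.

Lemma colored_child d P (S : {set leaf d.+1}) a : colored P S -> colored P (child S a).
Proof.
move=> PS x y z; rewrite !inE => xS yS zS xy yz xz c Ec.
by apply: (PS _ _ _ xS yS zS); rewrite ?xpair_eqE ?eqxx //= ?eqxx.
Qed.

Lemma level_child d (S : {set leaf d.+1}) a j : level (child S a) j -> level S j.
Proof.
case=> x [y []]; rewrite !inE => xS yS xy Ej.
by exists (a, x), (a, y); rewrite xpair_eqE /= eqxx.
Qed.

Lemma level_top d (S : {set leaf d.+1}) : 1 < #|roots S| -> level S d.
Proof.
case/card_gt1P => a [b []] /imsetP[x xS ->] /imsetP[y yS ->] xy.
exists x, y; split=> //; last by rewrite /= (negPf xy).
by apply: contraNneq xy => ->.
Qed.

(** Two points under [a] that separate at level [j], with any point under [b], form a triple of this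
    color. *)
Lemma colored_side d P (S : {set leaf d.+1}) a b j : colored P S ->
  b \in roots S -> b != a -> level (child S a) j -> P (inr (a < b, phi d j)).
Proof.
move=> PS /imsetP[[b' z] zS /= ->] ba [x [y []]]; rewrite !inE => xS yS xy <-.
by apply: (PS _ _ _ xS yS zS); rewrite ?xpair_eqE ?eqxx //= 1?eq_sym ?(negPf ba) ?eqxx.
Qed.

(** One leaf below each of the three children gives a triple that separates at the root. *)
Lemma colored_roots d P (S : {set leaf d.+1}) e : colored P S ->
  e \in triples (roots S) -> P (inl (chi e)).
Proof.
move=> PS; rewrite inE => /andP[eS /eqP e3].
have /card_gt2P[a [b [c [[ae be ce] [ab bc ca]]]]] : 2 < #|e| by rewrite e3.
have Ee : e = [set a; b; c].
  apply/esym/eqP; rewrite eqEcard !finset.subUset !finset.sub1set ae be ce e3.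
  by rewrite -finset.setUA !cardsU1 cards1 !inE negb_or ab bc eq_sym ca.
move/(fintype.subsetP eS): ae => /imsetP[x xS Ea].
move/(fintype.subsetP eS): be => /imsetP[y yS Eb].
move/(fintype.subsetP eS): ce => /imsetP[z zS Ec].
have ac : a != c by rewrite eq_sym.
rewrite {}Ee; subst a b c; apply: (PS _ _ _ xS yS zS).
- by apply: contraNneq ab => ->.
- by apply: contraNneq bc => ->.
- by apply: contraNneq ac => ->.
by rewrite /= (negPf ab) (negPf bc) (negPf ac).
Qed.

Lemma level_of_card d (S : {set leaf d}) : 1 < #|S| -> exists j, level S j.
Proof. by case/card_gt1P => x [y [xS yS xy]]; exists (split_level x y), x, y. Qed.


(** * Size of a subtree with restricted colors *)

Lemma card_roots_le2 d (P : color -> bool) (S : {set leaf d.+1}) :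
  (forall c, ~~ P (inl c)) -> colored P S -> #|roots S| <= 2.
Proof.
move=> NP PS; rewrite leqNgt; apply/negP => /subset_of_card[e eS e3].
have := NP (chi e); rewrite (colored_roots PS) //.
by rewrite inE eS e3 /=.
Qed.

(* On each branch, K collects the levels left through the lower child and K'
   those left through the upper one; the larger subtree is followed. *)
Lemma two_sided (a b : bool) (P : color -> bool) :
    (forall c, ~~ P (inl c)) -> (forall x, P (inr (true, x)) -> x = a) ->
    (forall x, P (inr (false, x)) -> x = b) ->
  forall d (S : {set leaf d}), colored P S -> exists K K' : seq nat,
  [/\ (forall j, j \in K ++ K' -> level S j),
     pairwise [rel i j | (j < i) && (phi i j == a)] K,
     pairwise [rel i j | (j < i) && (phi i j == b)] K'
   & #|S| <= 2 ^ (size K + size K')].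
Proof.
move=> NP Pa Pb; elim=> [|d IH] S PS.
  by exists [::], [::]; split=> //=; rewrite (leq_trans (max_card _)) // card_unit.
have [r0|[c cR]] := set_0Vmem (roots S).
  by exists [::], [::]; split=> //; rewrite card_child r0 big_set0.
have [r1|r2] := leqP #|roots S| 1.
  have Er : roots S = [set c].
    by apply/esym/eqP; rewrite eqEcard finset.sub1set cR cards1.
  have [K [K' [lev pK pK' leS]]] := IH _ (colored_child (a := c) PS).
  exists K, K'; split=> //; last by rewrite card_child Er big_set1.
  by move=> j /lev /level_child.
have {c cR} [c [e [ce Er]]] : exists c e : 'I_M, c < e /\ roots S = [set c; e].
  have /eqP/cards2P[c' [e [ce Er]]] : #|roots S| = 2.
    by apply/eqP; rewrite eqn_leq r2 (card_roots_le2 NP).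
  have := ltngtP c' e; case=> [lt|gt|eq]; first by exists c', e.
    by exists e, c'; rewrite finset.setUC.
  by rewrite (val_inj eq) eqxx in ce.
have ne : e != c by rewrite neq_ltn ce orbT.
have cR : c \in roots S by rewrite Er !inE eqxx.
have eR : e \in roots S by rewrite Er !inE eqxx orbT.
have ES : #|S| = #|child S c| + #|child S e|.
  by rewrite card_child Er big_setU1 ?big_set1 // !inE eq_sym.
have [K1 [K1' [lev1 pK1 pK1' leS1]]] := IH _ (colored_child (a := c) PS).
have [K2 [K2' [lev2 pK2 pK2' leS2]]] := IH _ (colored_child (a := e) PS).
(* The larger child holds at least half of [S], so recording level [d] pays for the factor 2. *)
have [le21|le12] := leqP #|child S e| #|child S c|.
  exists (d :: K1), K1'; split=> //=; first last.
  - by rewrite ES addSn expnS; lia.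
  - rewrite pK1 andbT; apply/allP => j jK.
    have {}lev1 : level (child S c) j by apply: lev1; rewrite mem_cat jK.
    rewrite /= (level_lt lev1) /=; apply/eqP/Pa.
    by have := colored_side PS eR ne lev1; rewrite ce.
  - by move=> j; rewrite inE => /predU1P[->|/lev1/level_child//]; exact: level_top.
exists K2, (d :: K2'); split=> //=; first last.
- by rewrite ES addnS expnS; lia.
- rewrite pK2' andbT; apply/allP => j jK.
  have {}lev2 : level (child S e) j by apply: lev2; rewrite mem_cat jK orbT.
  rewrite /= (level_lt lev2) /=; apply/eqP/Pb.
  have ce' : c != e by rewrite eq_sym.
  by have := colored_side PS cR ce' lev2; rewrite ltnNge ltnW.
move=> j; rewrite mem_cat inE orbCA -mem_cat => /predU1P[->|/lev2/level_child//].
exact: level_top.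
Qed.

(* Two children with at least two leaves would produce both sides, so the tree
   is a caterpillar. *)
Lemma one_sided (s : bool) (B : nat) (P : color -> bool) :
    (forall s' x, P (inr (s', x)) -> s' = s) ->
    (forall d (T : {set leaf d.+1}), colored P T -> #|roots T| <= B.+1) ->
  forall d (S : {set leaf d}), colored P S -> exists K : seq nat,
  [/\ (forall j, j \in K -> level S j),
     pairwise [rel i j | (j < i) && P (inr (s, phi i j))] K
   & #|S| <= (size K * B).+1].
Proof.
move=> Ps PB; elim=> [|d IH] S PS.
  by exists [::]; split=> //=; rewrite (leq_trans (max_card _)) // card_unit.
have [r0|[c0 c0R]] := set_0Vmem (roots S).
  by exists [::]; split=> //; rewrite card_child r0 big_set0.
have [r1|r2] := leqP #|roots S| 1.
  have Er : roots S = [set c0].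
    by apply/esym/eqP; rewrite eqEcard finset.sub1set c0R cards1.
  have [K [lev pK leS]] := IH _ (colored_child (a := c0) PS).
  exists K; split=> //; last by rewrite card_child Er big_set1.
  by move=> j /lev /level_child.
pose a := [arg max_(a > c0 in roots S) #|child S a|].
have [aR maxa] : a \in roots S /\ forall c, c \in roots S -> #|child S c| <= #|child S a|.
  by rewrite /a; case: arg_maxnP => // a' a'R maxa'; split.
have small c : c \in roots S -> c != a -> #|child S c| <= 1.
  move=> cR ca; rewrite leqNgt; apply/negP => c2.
  have [j levc] := level_of_card c2.
  have [j' leva] := level_of_card (leq_trans c2 (maxa c cR)).
  have := Ps _ _ (colored_side PS cR ca leva).
  rewrite -(Ps _ _ (colored_side PS aR _ levc)) 1?eq_sym //.
  by move: ca; rewrite -val_eqE /=; case: ltngtP.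
have [c cR ca] : exists2 c, c \in roots S & c != a.
  have /card_gt0P[c] : 0 < #|roots S :\ a| by move: r2; rewrite (cardsD1 a) aR.
  by rewrite !inE => /andP[]; exists c.
have [K [lev pK leS]] := IH _ (colored_child (a := a) PS).
exists (d :: K); split=> /=.
- by move=> j; rewrite inE => /predU1P[->|/lev/level_child//]; exact: level_top.
- rewrite pK andbT; apply/allP => j /lev levj; rewrite /= (level_lt levj) /=.
  have Pc := colored_side PS cR ca levj.
  by rewrite -(Ps _ _ Pc).
(* Children other than [a] are single leaves and number at most [B], the contribution of level
   [d]. *)
rewrite card_child (bigD1 a) //= mulSn.
have : \sum_(c in roots S | c != a) #|child S c| <= #|roots S :\ a|.
  rewrite -sum1_card [leqRHS](eq_bigl (fun c => (c \in roots S) && (c != a))).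
    by apply: leq_sum => i /andP[]; exact: small.
  by move=> i; rewrite !inE andbC.
have := PB _ _ PS; rewrite (cardsD1 a (roots S)) aR add1n ltnS => le1 le2.
by rewrite addnC -addnS leq_add // (leq_trans le2).
Qed.

(** The order of [enum] is immaterial by the symmetry of [tri]; the default color is never taken on
    triples. *)
Definition leaf_coloring d (e : {set leaf d}) : color :=
  if enum e is [:: x; y; z] then odflt (inr (true, true)) (tri x y z)
  else inr (true, true).

Lemma leaf_coloring_tri d (x y z : leaf d) c :
  x != y -> y != z -> x != z -> tri x y z = Some c ->
  leaf_coloring [set x; y; z] = c.
Proof.
move=> xy yz xz Ec; rewrite /leaf_coloring.
have e3 : #|[set x; y; z]| = 3.
  by rewrite -finset.setUA !cardsU1 cards1 !inE negb_or xy yz xz.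
have := enum_uniq [set x; y; z].
have : forall u, u \in enum [set x; y; z] -> [|| u == x, u == y | u == z].
  by move=> u; rewrite mem_enum !inE orbA.
move: e3; rewrite cardE; case: (enum _) => [|u [|v [|w [|]]]] //= _ mem.
rewrite !inE negb_or andbT => /andP[/andP[uv uw] vw].
have := mem u; have := mem v; have := mem w; rewrite !inE !eqxx !orbT.
(* Distinctness leaves the six orders of [x], [y], [z], each reached by at most three
   transpositions. *)
case/(_ isT)/or3P => /eqP Ew; case/(_ isT)/or3P => /eqP Ev;
  case/(_ isT)/or3P => /eqP Eu; subst u v w; rewrite ?eqxx // in uv uw vw *;
  by rewrite -[c]/(odflt (inr (true, true)) (Some c)) -Ec;
     first [ by [] | by rewrite triC12 | by rewrite triC23
           | by rewrite triC12 triC23 | by rewrite triC23 triC12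
           | by rewrite triC12 triC23 triC12 ].
Qed.

End ProductColoring.

(** The three bounds below [n] rule out, in order: both sides present; one side without colors of
    [chi]; one side with a color of [chi]. *)
Lemma has_good_coloring_exp (m n p q d w M : nat) :
    0 < w -> d ^ 2 <= 2 ^ w -> p + 4 <= q ->
    4 ^ w < n -> d.+1 < n -> (w * m.-1).+1 < n ->
  has_good_coloring m p 3 M -> has_good_coloring n q 3 (M ^ d).
Proof.
move=> w_gt0 le_dw le_pq lt_wn lt_dn lt_mn [chi chiP].
have [phi phiP] := ramsey_lower w_gt0 le_dw.
rewrite -(card_leaf M d).
apply: (@has_good_coloring_finType _ _ _ _ _ (@leaf_coloring _ _ chi phi d)).
  by rewrite card_sum card_ord card_prod card_bool.
move=> S cardS; rewrite leqNgt; apply/negP; rewrite ltnS.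
set Cs := [set _ | _ in _] => Cs2; pose P c := c \in Cs.
have PS : colored chi phi P S.
  move=> x y z xS yS zS xy yz xz c Ec; rewrite /P -(leaf_coloring_tri xy yz xz Ec).
  apply: imset_f; rewrite inE !finset.subUset !finset.sub1set xS yS zS /=.
  by rewrite -finset.setUA !cardsU1 cards1 !inE negb_or xy yz xz.
(* More than [m] children would carry three colors of [chi]. The form [m.-1.+1] fits [one_sided]
   with [B = m.-1]. *)
have rootsP d' (T : {set leaf M d'.+1}) : colored chi phi P T -> #|roots T| <= m.-1.+1.
  move=> PT; apply: (@leq_trans m); last by case: (m).
  rewrite leqNgt; apply/negP => /ltnW/subset_of_card[A AT /chiP].
  rewrite leqNgt => /negP; apply; rewrite ltnS; apply: leq_trans Cs2.
  rewrite -(card_imset _ (@inl_inj _ (bool * bool))).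
  apply/subset_leq_card/fintype.subsetP => y /imsetP[_ /imsetP[e eA ->] ->].
  apply: (colored_roots PT); move: eA; rewrite !inE => /andP[eA ->].
  by rewrite (fintype.subset_trans eA).
have pair_eq c c' : P c -> P c' -> c != c' -> Cs = [set c; c'].
  move=> Pc Pc' cc'; apply/esym/eqP.
  rewrite eqEcard finset.subUset !finset.sub1set -/(P c) -/(P c').
  by rewrite Pc Pc' cards2 cc'.
have lev_lt (K : seq nat) : (forall j, j \in K -> level S j) -> all (fun j => j < d) K.
  by move=> levK; apply/allP => j /levK/level_lt.
have [[[a Pa] [b Pb]] | Nboth] :=
    pselect ((exists a, P (inr (true, a))) /\ exists b, P (inr (false, b))).
  have ECs := pair_eq _ _ Pa Pb isT.
  have [|x|x|K [K' [lev pK pK' leS]]] := @two_sided _ _ chi phi a b P _ _ _ d S PS.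
  - by move=> c; rewrite /P ECs !inE.
  - by rewrite /P ECs !inE => /orP[/eqP[]|//].
  - by rewrite /P ECs !inE => /orP[//|/eqP[]].
  have wK : size K <= w.
    by apply: (phiP a) pK; apply: lev_lt => j jK; apply: lev; rewrite mem_cat jK.
  have wK' : size K' <= w.
    by apply: (phiP b) pK'; apply: lev_lt => j jK; apply: lev; rewrite mem_cat jK orbT.
  move: lt_wn; rewrite -cardS ltnNge (leq_trans leS) //.
  by rewrite -(expnM 2 2 w) leq_exp2l // mul2n -addnn leq_add.
have [s Ps] : exists s, forall s' x, P (inr (s', x)) -> s' = s.
  have [[a Pa] | NL] := pselect (exists a, P (inr (true, a))).
    exists true => -[] x Px //.
    by case: Nboth; split; [exists a | exists x].
  (* This choice also covers the absence of both sides. *)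
  exists false => -[] x Px //.
  by case: NL; exists x.
have [[c Pc] | Ninl] := pselect (exists c, P (inl c)).
  have [K [lev pK leS]] := one_sided Ps rootsP PS.
  (* The color [inl c] leaves room for one further color, so [phi] is constant on [K]. *)
  have [a Pa] : exists a, forall x, P (inr (s, x)) -> x = a.
    have [Pt | NPt] := boolP (P (inr (s, true))); last first.
      by exists false => -[] // Pt; rewrite Pt in NPt.
    exists true => -[] //; rewrite /P (pair_eq _ _ Pc Pt) // !inE /=.
    by case/eqP.
  have wK : size K <= w.
    apply: (phiP a); first exact: lev_lt.
    by apply: sub_pairwise pK => i j /= /andP[-> /Pa ->] /=.
  move: lt_mn; rewrite -cardS ltnNge (leq_trans leS) //.
  by rewrite ltnS leq_mul2r wK orbT.
have NP c : ~~ P (inl c) by apply/negP => Pc; apply: Ninl; exists c.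
(* The tree is binary, so [B = 1]; [K] consists of distinct levels below [d]. *)
have [K [lev pK leS]] :=
  one_sided Ps (fun d' T => @card_roots_le2 _ _ _ _ d' P T NP) PS.
have dK : size K <= d.
  rewrite -(size_iota 0 d); apply: uniq_leq_size => [|j /lev/level_lt].
    have : pairwise gtn K by apply: sub_pairwise pK => i j /andP[].
    by move=> /(pairwise_uniq (fun i => ltnn i)).
  by rewrite mem_iota.
by move: lt_dn; rewrite -cardS ltnNge (leq_trans leS) // muln1 ltnS.
Qed.

(** * Choice of parameters and passage to real exponents *)

Lemma sqr_le_exp2 (d w : nat) : 0 < w -> 4 * d ^ 4 < 4 ^ w -> d.+1 ^ 2 <= 2 ^ w.
Proof.
move=> w_gt0 lt4.
have lt2 : 2 * d ^ 2 < 2 ^ w.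
  rewrite -ltn_sqr -!expnM (mulnC w) (expnM 2 2 w); apply: leq_trans lt4.
  by rewrite expnMn -expnM.
(* From [2 ^ w >= 16] on, [2 * d ^ 2 < 2 ^ w] suffices; smaller [w] are checked singly. *)
case: w w_gt0 {lt4} lt2 => [|[|[|[|w]]]] // _ lt2.
- have : d = 0 by move: lt2; rewrite -mulnn; nia.
  by move=> ->.
- have : d <= 1 by move: lt2; rewrite -mulnn; nia.
  by move: (d) => [|[|]].
- have : d <= 1 by move: lt2; rewrite -mulnn; nia.
  by move: (d) => [|[|]].
have : 16 <= 2 ^ w.+4 by rewrite (@leq_exp2l 2 4).
move: lt2; rewrite -!mulnn; nia.
Qed.

(** Take [d] minimal with [n <= (2 * d) ^ 4] and [w] maximal with [4 ^ w < n]. Then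
    [(2 * d.-1) ^ 4 < n <= 4 ^ w.+1], which gives [4 * d.-1 ^ 4 < 4 ^ w]. *)
Lemma exists_depth_clique (n : nat) : 9 < n ->
  exists d w, [/\ n <= (2 * d) ^ 4, 0 < w, d ^ 2 <= 2 ^ w, 4 ^ w < n & d.+1 < n].
Proof.
move=> n_gt9.
have exd : exists d, n <= (2 * d) ^ 4.
  exists n; apply: leq_trans (leq_pexp2l _ (isT : 1 <= 4)); rewrite ?expn1; lia.
have exw : exists w, 4 ^ w < n by exists 0; lia.
have bnd w : 4 ^ w < n -> w <= n.
  by move=> lt; apply/ltnW/(leq_trans _ (ltnW lt))/ltn_expl.
case: (ex_minnP exd) => d le_nd mind; case: (ex_maxnP exw bnd) => w lt_wn maxw.
have w_gt0 : 0 < w by apply: maxw; lia.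
have le_nw : n <= 4 ^ w.+1.
  by rewrite leqNgt; apply/negP => /maxw; rewrite ltnn.
case: d le_nd mind => [|d] le_nd mind; first by move: le_nd; rewrite muln0 exp0n; lia.
have lt_dn : (2 * d) ^ 4 < n.
  by rewrite ltnNge; apply/negP => /mind; rewrite ltnn.
exists d.+1, w; split=> //.
  apply: sqr_le_exp2 => //; move: lt_dn le_nw; rewrite expnMn (expnS 4).
  by rewrite -[2 ^ 4]/(4 * 4); lia.
have : d <= d ^ 4 by case: (d) => // k; rewrite -{1}[k.+1]expn1 leq_pexp2l.
by move: lt_dn; rewrite expnMn -[2 ^ 4]/16; lia.
Qed.

Import Order.TTheory GRing.Theory Num.Theory.
Local Open Scope ring_scope.

Lemma ln_nat_le_expn (R : realType) (m n a b : nat) : (0 < m)%N ->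
  (ln m%:R *+ a <= ln n%:R *+ b :> R) -> (0 < n)%N -> (m ^ a <= n ^ b)%N.
Proof.
move=> m_gt0 le n_gt0; rewrite -(ler_nat R) !natrX.
rewrite -ler_ln ?posrE ?exprn_gt0 ?ltr0n // !lnXn ?ltr0n //.
Qed.

Theorem theorem3p2 (R : realType) (n q : nat) (hq : (9 <= q)%N)
  (hqn : (q < n)%N) :
  (f (Num.truncn (n%:R / log2 (n%:R : R))) (q - 6) 3)%:R
      `^ ((n%:R `^ (1 / 4)) / 2)
    <= (f n q 3)%:R :> R.
Proof.
set m := Num.truncn _.
have n_gt9 : (9 < n)%N by lia.
have [d [w [le_nd w_gt0 le_dw lt_wn lt_dn]]] := exists_depth_clique n_gt9.
have ln2_gt0 : 0 < ln 2 :> R by rewrite ln_gt0 // ltr1n.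
have lnn_gt0 : 0 < ln n%:R :> R by rewrite ln_gt0 // ltr1n; lia.
(* This is [m * log2 n <= n] in exponential form. *)
have le_m : (n ^ m <= 2 ^ n)%N.
  apply: (@ln_nat_le_expn R); [lia| |by []].
  rewrite -[leLHS]mulr_natl -[leRHS]mulr_natl.
  have : m%:R <= n%:R / log2 (n%:R : R).
    by rewrite truncn_le // divr_ge0 // /log2 divr_ge0 // ltW.
  by rewrite /log2 invf_div mulrA ler_pdivlMr.
have m_gt0 : (0 < m)%N.
  rewrite truncn_gt0 /log2 invf_div mulrA ler_pdivlMr // mul1r.
  rewrite mulr_natl -lnXn // ler_ln ?posrE ?exprn_gt0 ?ltr0n //; last by lia.
  by rewrite -natrX ler_nat ltnW // ltn_expl.
(* Raise [4 ^ w < n] to the power [m] and apply [le_m]. *)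
have lt_wm : (w * m < n)%N.
  have lt : (4 ^ (w * m) < 2 ^ n)%N.
    by apply: leq_trans le_m; rewrite expnM ltn_exp2r.
  by rewrite -(@ltn_exp2l 2) // (leq_ltn_trans _ lt) // leq_exp2r // muln_gt0 w_gt0.
have [gM _] : is_max (has_good_coloring m (q - 6) 3) (f m (q - 6) 3).
  by apply: f_is_max => //; lia.
have [_ maxf] : is_max (has_good_coloring n q 3) (f n q 3).
  by apply: f_is_max => //; lia.
have le_f : (f m (q - 6) 3 ^ d <= f n q 3)%N.
  apply: maxf; apply: (has_good_coloring_exp w_gt0 le_dw _ lt_wn lt_dn _ gM); first by lia.
  by apply: leq_ltn_trans lt_wm; case: (m) m_gt0 => // k _; nia.
have x_gt0 : 0 < (n%:R `^ (1 / 4)) / 2 :> R.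
  by rewrite divr_gt0 // powR_gt0 // ltr0n; lia.
have le_xd : (n%:R `^ (1 / 4)) / 2 <= d%:R :> R.
  rewrite ler_pdivrMr // -natrM mulnC.
  have -> : (2 * d)%:R = ((2 * d) ^ 4)%:R `^ (1 / 4) :> R.
    by rewrite natrX -powR_mulrn // -powRrM mulrA mulr1 divff // powRr1.
  by rewrite ge0_ler_powR ?nnegrE // ?ler_nat // divr_ge0.
(* Monotonicity in the exponent needs a base at least 1; base 0 has power 0, the exponent being
   positive. *)
case: (f m (q - 6) 3) le_f => [|M'] le_f.
  by rewrite powR0 ?ler0n // gt_eqF.
apply: (@le_trans _ _ (M'.+1%:R `^ d%:R)); last by rewrite powR_mulrn // -natrX ler_nat.
by rewrite ler_powR // ler1n.
Qed.
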